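(* Let $\omega=(\omega_1,\omega_2,\omega_3)$ be a vector of positive integers, and consider the 3-dimensional polynomial slow-fast system $$x'=P(x,y,z,\varepsilon),\qquad y'=\varepsilon Q(x,y,z,\varepsilon),\qquad z'=\varepsilon R(x,y,z,\varepsilon)$$ with associated vector field $X_\varepsilon$, and its Poincaré--Lyapunov compactification $X^\infty_\varepsilon$ with weight $\omega$. If $\deg_\omega X_\varepsilon=\delta$, then the following hold for all positive integers $k_1,k_2$: (a) If $P_\delta(x,y,z,\varepsilon)=x^2y^{k_1}-y^{k_2}z$, then the critical manifold of the compactified vector field $X_\varepsilon^\infty$ has a fold singularity at the origin of the chart $U_2$ if and only if $k_1\omega_2=\delta-\omega_1$ and $k_2\omega_2=\delta+\omega_1-\omega_3$. (b) If $P_\delta(x,y,z,\varepsilon)=x^2y^{k_1}-y^{k_2}z^2$, then the critical manifold of the compactified vector field $X_\varepsilon^\infty$ has a transcritical singularity at the origin of the chart $U_2$ if and only if $k_1\omega_2=\delta-\omega_1$ and $k_2\omega_2=\delta+\omega_1-2\omega_3$. (c) If $P_\delta(x,y,z,\varepsilon)=xy^{k_1}z-x^3y^{k_2}$, then the critical manifold of the compactified vector field $X_\varepsilon^\infty$ has a pitchfork singularity at the origin of the chart $U_2$ if and only if $k_1\omega_2=\delta-\omega_3$ and $k_2\omega_2=\delta-2\omega_1$.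
   Context: $P,Q,R$ are polynomial in $(x,y,z)$ and analytic in $\varepsilon$. A polynomial $F$ is quasi-homogeneous of type $\omega$ and degree $k$ if $F(\lambda^{\omega_1}x,\lambda^{\omega_2}y,\lambda^{\omega_3}z)=\lambda^kF(x,y,z)$ for all $\lambda\in\mathbb R$. Write $P=\sum_dP_d$, $Q=\sum_dQ_d$, $R=\sum_dR_d$, where $P_d,Q_d,R_d$ are the components quasi-homogeneous of type $\omega$ and degrees $d+\omega_1$, $d+\omega_2$, $d+\omega_3$ in $(x,y,z)$, respectively. $\deg_\omega X_\varepsilon=\delta$ is the largest $d$ for which at least one of $P_d,Q_d,R_d$ is nonzero; $P_\delta$ is the highest quasi-homogeneous degree component of $P$. Chart $U_2$ of the Poincaré--Lyapunov compactification has coordinates $(u,v,w)$ with $x=u/w^{\omega_1}$, $y=1/w^{\omega_2}$, $z=v/w^{\omega_3}$; after multiplying by $w^\delta$ the compactified vector field $X^\infty_\varepsilon$ is $$u'=w^{\delta+\omega_1}P-\varepsilon\tfrac{\omega_1}{\omega_2}u\,w^{\delta+\omega_2}Q,\qquad v'=\varepsilon\Big(w^{\delta+\omega_3}R-\tfrac{\omega_3}{\omega_2}v\,w^{\delta+\omega_2}Q\Big),\qquad w'=-\tfrac{\varepsilon}{\omega_2}w^{\delta+\omega_2+1}Q,$$ with $P,Q,R$ evaluated at $(u/w^{\omega_1},1/w^{\omega_2},v/w^{\omega_3},\varepsilon)$; equivalently $w^{\delta+\omega_1}P=\sum_{d\le\delta}w^{\delta-d}P_d(u,1,v,\varepsilon)$,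 and similarly for $Q,R$. The set $\{w=0\}$ is invariant and represents infinity. Restricting to infinity $\{w=0\}$ gives a planar system $u'=f(u,v,\varepsilon)$, $v'=\varepsilon g(u,v,\varepsilon)$, with critical manifold $\{f(u,v,0)=0\}$. The non-degeneracy conditions for a singularity of such a planar slow-fast system at the origin $(u,v)=(0,0)$ are as follows (all functions evaluated at $(0,0,0)$): - fold singularity: $f_u=0$, $f_{uu}\neq0$, $f_v\neq0$ and $g\neq0$; - transcritical singularity: $f=f_u=f_v=0$, $\det\operatorname{Hes}(f)<0$, $f_{uu}\neq0$ and $g\neq0$, where $\operatorname{Hes}(f)$ is the Hessian matrix of $f$ with respect to $(u,v)$; - pitchfork singularity: $f=f_u=f_{uu}=f_v=0$, $f_{uuu}\neq0$, $f_{uv}\neq0$ and $g\neq0$.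
   Formalization: The formal theorem adds the hypothesis g(0,0,0) ≠ 0 for the system at infinity (i.e. R_δ(0,1,0,0) ≠ 0); without it the ''if'' directions fail, e.g. Q = R = 0, ω = (1,1,1), P = x²y − y²z, δ = 2. *)

(* Defs.v *)
From HB Require Import structures.
From mathcomp Require Import all_boot all_order all_algebra.
From mathcomp Require Import mpoly.
From mathcomp Require Import classical_sets reals topology normedtype sequences.
From mathcomp Require Import derive.
Set Implicit Arguments.
Unset Strict Implicit.
Unset Printing Implicit Defensive.
Import Order.TTheory GRing.Theory Num.Theory.
Import numFieldNormedType.Exports.
Local Open Scope ring_scope.
Local Open Scope classical_set_scope.

Definition ix : 'I_3 := @Ordinal 3 0 isT.
Definition iy : 'I_3 := @Ordinal 3 1 isT.
Definition iz : 'I_3 := @Ordinal 3 2 isT.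

Definition pt (K : Type) (a b c : K) : 'I_3 -> K := tnth [tuple a; b; c].

Section AnalyticFamilies.
Context {K : realType}.

Definition analytic_at (h : K -> K) (a : K) : Prop :=
  exists c : nat -> K,
    \forall e \near a, series (fun n => c n * (e - a) ^+ n) @ \oo --> h e.

(* F(x,y,z,eps): polynomial in (x,y,z) with a degree bound independent of eps
   and coefficients that are analytic functions of eps on (-eps0, eps0);
   values of F outside this interval are irrelevant. *)
Definition analytic_family (eps0 : K) (F : K -> {mpoly K[3]}) : Prop :=
  (exists N : nat, forall e, `|e| < eps0 -> (msize (F e) <= N)%N) /\
  (forall (m : 'X_{1..3}) (a : K), `|a| < eps0 ->
     analytic_at (fun e => (F e)@_m) a).

End AnalyticFamilies.

Section QuasiHomogeneous.
Context {K : realType}.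
Variable w : 'I_3 -> nat.

Definition quasihom (k : nat) (F : {mpoly K[3]}) : Prop :=
  forall (l : K) (x : 'I_3 -> K),
    F.@[fun j => l ^+ w j * x j] = l ^+ k * F.@[x].

Definition wdeg (m : 'X_{1..3}) : nat := (\sum_(j < 3) w j * m j)%N.

(* The component F_d of F, quasi-homogeneous of degree d + w i; here i = ix for
   P, iy for Q and iz for R.  Note that d may be negative. *)
Definition wcomp (i : 'I_3) (d : int) (F : {mpoly K[3]}) : {mpoly K[3]} :=
  \sum_(m <- msupp F | (wdeg m)%:Z == d + (w i)%:Z) F@_m *: 'X_[m].

(* deg_w X_eps = delta *)
Definition is_wdegree (eps0 : K) (P Q R : K -> {mpoly K[3]}) (delta : int) :
    Prop :=
  let nonzero d := exists e : K, `|e| < eps0 /\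
    (wcomp ix d (P e) != 0 \/ wcomp iy d (Q e) != 0 \/ wcomp iz d (R e) != 0)
  in nonzero delta /\ forall d : int, nonzero d -> d <= delta.

(* s^(delta + w i) F(u/s^w1, 1/s^w2, v/s^w3), where s is the third chart
   coordinate and w1, w2, w3 are the weights, in the polynomial form
   \sum_(d <= delta) s^(delta - d) F_d(u,1,v), which makes sense at s = 0;
   here d = k - w i with k >= 0.  Off s = 0 the two forms agree by clearE. *)
Definition clear (delta : int) (i : 'I_3) (F : {mpoly K[3]}) (u v s : K) : K :=
  \sum_(0 <= k < (absz (delta + (w i)%:Z)%R).+1 | k%:Z - (w i)%:Z <= delta)
    s ^+ absz (delta - (k%:Z - (w i)%:Z))%R *
      (wcomp i (k%:Z - (w i)%:Z) F).@[pt u 1 v].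

Lemma wcomp_quasihom (i : 'I_3) (k : nat) (F : {mpoly K[3]}) :
  quasihom k (wcomp i (k%:Z - (w i)%:Z) F).
Proof.
move=> l x; rewrite /wcomp !raddf_sum mulr_sumr /=; apply: eq_bigr => m.
rewrite subrK => /eqP [] <-; rewrite !mevalZ !mevalX /wdeg.
under eq_bigr => j _ do rewrite exprMn -exprM.
by rewrite big_split /= -expr_sum mulrCA.
Qed.

Lemma sum_wcomp (i : 'I_3) (N : nat) (F : {mpoly K[3]}) :
  (forall m, m \in msupp F -> (wdeg m < N)%N) ->
  \sum_(0 <= k < N) wcomp i (k%:Z - (w i)%:Z) F = F.
Proof.
move=> HN; rewrite [RHS]mpolyE /wcomp.
under eq_bigr => k _ do rewrite big_mkcond /=.
rewrite exchange_big /=; apply: eq_big_seq => m mF.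
rewrite (bigD1_seq (wdeg m)) ?iota_uniq //=; last first.
  by rewrite mem_index_iota HN.
rewrite subrK eqxx big1 ?addr0 // => k; rewrite subrK.
by rewrite eqz_nat eq_sym => /negPf ->.
Qed.

Lemma clearE (delta : int) (i : 'I_3) (F : {mpoly K[3]}) (u v s : K) :
  s != 0 -> (forall d, delta < d -> wcomp i d F = 0) ->
  clear delta i F u v s =
  s ^ (delta + (w i)%:Z) *
    F.@[pt (u / s ^+ w ix) (1 / s ^+ w iy) (v / s ^+ w iz)].
Proof.
move=> s0 HF; set x := pt _ _ _.
have evE k d : d = k%:Z - (w i)%:Z -> d <= delta ->
    s ^+ absz (delta - d)%R * (wcomp i d F).@[pt u 1 v] =
    s ^ (delta + (w i)%:Z) * (wcomp i d F).@[x].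
  move=> dE dle; have -> : (wcomp i d F).@[pt u 1 v] =
      s ^+ k * (wcomp i d F).@[x].
    rewrite dE -wcomp_quasihom; apply: meval_eq => j.
    have : [\/ j = ix, j = iy | j = iz].
    - case: j => -[|[|[|//]]] ltj;
        [apply: Or31|apply: Or32|apply: Or33]; exact: val_inj.
    by case=> ->; rewrite /x /pt !(tnth_nth 0) /= mulrCA mulfV
      ?expf_neq0 ?mulr1.
  rewrite mulrA; congr (_ * _).
  rewrite -[s ^+ absz _]/(s ^ (absz _)%:Z) gez0_abs ?subr_ge0 //.
  by rewrite -[s ^+ k]/(s ^ k%:Z) -expfzDr // dE opprB addrA addrNK addrC.
have evZ k : (wcomp i (k%:Z - (w i)%:Z) F) != 0 -> k%:Z - (w i)%:Z <= delta.
  by apply: contraR; rewrite -ltNge => /HF ->.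
rewrite /clear.
pose N := ((absz (delta + (w i)%:Z)%R).+1 + \sum_(m <- msupp F) (wdeg m).+1)%N.
have NF m : m \in msupp F -> (wdeg m < N)%N.
  move=> mF; rewrite /N (bigD1_seq m) ?msupp_uniq //=.
  by rewrite addnCA ltnS leq_addr.
rewrite -[in RHS](sum_wcomp i NF) raddf_sum /= mulr_sumr.
rewrite [RHS](@big_cat_nat _ _ _ (absz (delta + (w i)%:Z)%R).+1) //=; last first.
  exact: leq_addr.
rewrite [X in _ = _ + X]big_nat_cond [X in _ = _ + X]big1 ?addr0; last first.
  move=> k /andP[/andP[kge _] _].
  have [->|/evZ] := eqVneq (wcomp i (k%:Z - (w i)%:Z) F) 0.
    by rewrite meval0 mulr0.
  rewrite lerBlDr => kle; exfalso; move: kge; apply/negP; rewrite -ltnNge ltnS.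
  by rewrite -lez_nat gez0_abs //; apply: le_trans kle.
rewrite big_mkcond /=; apply: eq_bigr => k _; case: ifP => [|/negbT kgt].
  exact: evE.
have [->|/evZ] := eqVneq (wcomp i (k%:Z - (w i)%:Z) F) 0.
  by rewrite meval0 mulr0.
by rewrite (negPf kgt).
Qed.

End QuasiHomogeneous.

Section Compactification.
Context {K : realType}.
Variables (w : 'I_3 -> nat) (delta : int) (P Q R : K -> {mpoly K[3]}).

(* The compactified vector field in the chart U_2, with coordinates (u,v,s)
   and infinity {s = 0}; the v-component is e * U2_g. *)
Definition U2_u (u v s e : K) : K :=
  clear w delta ix (P e) u v s
  - e * ((w ix)%:R / (w iy)%:R) * u * clear w delta iy (Q e) u v s.

Definition U2_g (u v s e : K) : K :=
  clear w delta iz (R e) u v s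
  - (w iz)%:R / (w iy)%:R * v * clear w delta iy (Q e) u v s.

Definition U2_field (e : K) (p : K * K * K) : K * K * K :=
  let: (u, v, s) := p in
  (U2_u u v s e, e * U2_g u v s e,
   - (e / (w iy)%:R) * (s * clear w delta iy (Q e) u v s)).

(* The planar slow-fast system u' = f, v' = eps g at infinity {s = 0}. *)
Definition f_infty (u v e : K) : K := U2_u u v 0 e.
Definition g_infty (u v e : K) : K := U2_g u v 0 e.

Lemma U2_field_infty (u v e : K) :
  U2_field e (u, v, 0) = (f_infty u v e, e * g_infty u v e, 0).
Proof. by rewrite /U2_field mul0r mulr0. Qed.

End Compactification.

Section Singularities.
Context {K : realType}.
Implicit Types f g : K -> K -> K -> K.

Definition d_u f : K -> K -> K -> K := fun u v e => derive1 (fun t => f t v e) u.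
Definition d_v f : K -> K -> K -> K := fun u v e => derive1 (fun t => f u t e) v.

Definition hessian f (u v e : K) : 'M[K]_2 :=
  \matrix_(i, j)
    (let D (k : 'I_2) := if k == 0 then d_u else d_v in D i (D j f)) u v e.

Definition critical_manifold f : set (K * K) := [set p | f p.1 p.2 0 = 0].

(* Singularities at the origin of u' = f(u,v,eps), v' = eps g(u,v,eps).  That
   the origin lies on the critical manifold is part of each definition. *)
Definition fold_singularity f g : Prop :=
  critical_manifold f (0, 0) /\
  [/\ d_u f 0 0 0 = 0, d_u (d_u f) 0 0 0 != 0, d_v f 0 0 0 != 0
    & g 0 0 0 != 0].

Definition transcritical_singularity f g : Prop :=
  critical_manifold f (0, 0) /\
  [/\ d_u f 0 0 0 = 0 /\ d_v f 0 0 0 = 0, \det (hessian f 0 0 0) < 0,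
      d_u (d_u f) 0 0 0 != 0 & g 0 0 0 != 0].

Definition pitchfork_singularity f g : Prop :=
  critical_manifold f (0, 0) /\
  [/\ [/\ d_u f 0 0 0 = 0, d_u (d_u f) 0 0 0 = 0 & d_v f 0 0 0 = 0],
      d_u (d_u (d_u f)) 0 0 0 != 0, d_v (d_u f) 0 0 0 != 0 & g 0 0 0 != 0].

End Singularities.

(* Main.v *)
Require Import Defs.
From HB Require Import structures.
From mathcomp Require Import all_boot all_order all_algebra.
From mathcomp Require Import mpoly.
From mathcomp Require Import classical_sets reals topology normedtype sequences.
From mathcomp Require Import derive.
From mathcomp Require Import boolp zify ring.
Import Order.TTheory GRing.Theory Num.Theory.
Local Open Scope ring_scope.

(* At eps = 0 the flow at infinity is u' = P_delta(u,1,v), which does not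
   involve k1 and k2: the three normal forms restrict to u^2 - v, u^2 - v^2 and
   uv - u^3, so the singularity is always present.  The conditions on k1 and k2
   always hold as well: they say that the two monomials of P_delta have weighted
   degree delta + w1. *)

Section Weights.
Context {K : realType} (w : 'I_3 -> nat).

Lemma mcoeff_wcomp (i : 'I_3) (d : int) (F : {mpoly K[3]}) (m : 'X_{1..3}) :
  (wcomp w i d F)@_m != 0 -> (wdeg w m)%:Z = d + (w i)%:Z.
Proof.
move=> H; apply/eqP; apply: contraNT H => dm.
rewrite /wcomp raddf_sum big1 //= => m' dm'.
rewrite mcoeffZ mcoeffX; case: eqVneq => [E|]; last by rewrite mulr0.
by move: dm; rewrite -E dm'.
Qed.

(** Distinct monomials cannot cancel, so each keeps the coefficient 1 or -1 in the component and
    must have its weighted degree. This is the source of the equations for [k1] and [k2]. *)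
Lemma wcomp_binomial (i : 'I_3) (d : int) (F : {mpoly K[3]})
    (m m' : 'X_{1..3}) : m != m' -> wcomp w i d F = 'X_[m] - 'X_[m'] ->
  (wdeg w m)%:Z = d + (w i)%:Z /\ (wdeg w m')%:Z = d + (w i)%:Z.
Proof.
move=> mm' FE; split; apply: (@mcoeff_wcomp i d F); rewrite FE mcoeffB !mcoeffX.
- by rewrite eqxx [m' == m]eq_sym (negPf mm') subr0 oner_eq0.
- by rewrite eqxx (negPf mm') sub0r oppr_eq0 oner_eq0.
Qed.

Lemma wcomp_eq0 (i : 'I_3) (d : int) (F : {mpoly K[3]}) :
  d + (w i)%:Z < 0 -> wcomp w i d F = 0.
Proof.
move=> d0; rewrite /wcomp big1 // => m /eqP E; exfalso.
by move: d0; rewrite -E.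
Qed.

(** The component of degree [d] carries the factor [s ^+ (delta - d)]; at [s = 0] only [d = delta]
    survives, thanks to [0 ^+ 0 = 1]. *)
Lemma clear_infty (delta : int) (i : 'I_3) (F : {mpoly K[3]}) (u v : K) :
  clear w delta i F u v 0 = (wcomp w i delta F).@[pt u 1 v].
Proof.
rewrite /clear big_mkcond /=.
have term0 (k : nat) : k%:Z != delta + (w i)%:Z ->
    (if k%:Z - (w i)%:Z <= delta then
       0 ^+ absz (delta - (k%:Z - (w i)%:Z))%R *
         (wcomp w i (k%:Z - (w i)%:Z) F).@[pt u 1 v]
     else 0) = 0.
  move=> kn; case: ifP => // _; rewrite expr0n absz_eq0 subr_eq0.
  by rewrite [delta == _]eq_sym subr_eq (negPf kn) mul0r.
(* In the negative case no natural [k] equals [delta + w i], so every summand vanishes; the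
   component is zero as well, since weighted degrees are natural numbers. *)
have [dn|d0] := ltP (delta + (w i)%:Z) 0.
  rewrite wcomp_eq0 // meval0 big1 // => k _; apply: term0.
  by apply: contraTneq dn => <-.
rewrite (bigD1_seq (absz (delta + (w i)%:Z)%R)) ?iota_uniq //=; last first.
  by rewrite mem_index_iota ltnSn.
rewrite gez0_abs // addrK lexx subrr expr0 mul1r big1 ?addr0 // => k kn.
by apply: term0; apply: contraNneq kn => <-.
Qed.

(** The [Q] term of [U2_u] carries the factor eps and drops out at eps = 0. *)
Lemma f_infty0E (delta : int) (P Q : K -> {mpoly K[3]}) (u v : K) :
  f_infty w delta P Q u v 0 = (wcomp w ix delta (P 0)).@[pt u 1 v].
Proof. by rewrite /f_infty /U2_u !mul0r subr0 clear_infty. Qed.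

Lemma wdegE (m : 'X_{1..3}) :
  wdeg w m = (w ix * m ix + w iy * m iy + w iz * m iz)%N.
Proof.
rewrite /wdeg !big_ord_recl big_ord0 addn0 addnA.
by congr (_ * m _ + _ * m _ + _ * m _)%N; try congr w; apply: val_inj.
Qed.

End Weights.

Lemma meval_xyz (K : comNzRingType) (a b c : K) :
  [/\ ('X_ix : {mpoly K[3]}).@[pt a b c] = a,
      ('X_iy : {mpoly K[3]}).@[pt a b c] = b
    & ('X_iz : {mpoly K[3]}).@[pt a b c] = c].
Proof. by split; rewrite mevalXU /pt (tnth_nth 0). Qed.

Section Derivatives.
Context {K : realType} (f : K -> K -> K -> K) (e : K).

(** Replaces the analytic derivative by the formal derivative of a polynomial in [u] whose
    coefficients may depend on [v]. *)
Lemma d_u_horner (p : K -> {poly K}) :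
  (forall u v, f u v e = (p v).[u]) ->
  forall u v, d_u f u v e = (p v)^`().[u].
Proof.
move=> fE u v; rewrite derive.derivE /d_u.
by have -> : (fun t => f t v e) = horner (p v) by apply/funext => t.
Qed.

Lemma d_v_horner (q : K -> {poly K}) :
  (forall u v, f u v e = (q u).[v]) ->
  forall u v, d_v f u v e = (q u)^`().[v].
Proof.
move=> fE u v; rewrite derive.derivE /d_v.
by have -> : (fun t => f u t e) = horner (q u) by apply/funext => t.
Qed.

End Derivatives.

Section NormalForms.
Context {K : realType} (f g : K -> K -> K -> K).
Hypothesis g0 : g 0 0 0 != 0.

(** The critical manifold is the parabola [v = u ^+ 2]. The condition on [g] cannot follow from the
    shape of [f], so it enters as the hypothesis [g0]. *)
Lemma fold_normal_form :
  (forall u v, f u v 0 = u ^+ 2 - v) -> fold_singularity f g.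
Proof.
move=> fE.
(* The formula holds at every point and not only at the origin, because it is differentiated
   again. *)
have fu u v : d_u f u v 0 = u *+ 2.
  by rewrite (@d_u_horner _ _ _ (fun v => 'X^2 - v%:P)) => *;
    rewrite ?fE ?poly.derivE ?(hornerMn, hornerE) /=; ring.
have fuu u v : d_u (d_u f) u v 0 = 2.
  by rewrite (@d_u_horner _ _ _ (fun=> 'X *+ 2)) => *;
    rewrite ?fu ?poly.derivE ?(hornerMn, hornerE) /=; ring.
have fv u v : d_v f u v 0 = - 1.
  by rewrite (@d_v_horner _ _ _ (fun u => (u ^+ 2)%:P - 'X)) => *;
    rewrite ?fE ?poly.derivE ?(hornerMn, hornerE) /=; ring.
split; first by rewrite /critical_manifold /= fE expr0n subrr.
by split; rewrite ?fu ?fuu ?fv ?mul0rn ?pnatr_eq0 ?oppr_eq0 ?oner_eq0.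
Qed.

(** Since [f] factors as [(u - v) * (u + v)], two lines cross at the origin, and the Hessian is
    diagonal with entries 2 and -2. *)
Lemma transcritical_normal_form :
  (forall u v, f u v 0 = u ^+ 2 - v ^+ 2) -> transcritical_singularity f g.
Proof.
move=> fE.
have fu u v : d_u f u v 0 = u *+ 2.
  by rewrite (@d_u_horner _ _ _ (fun v => 'X^2 - (v ^+ 2)%:P)) => *;
    rewrite ?fE ?poly.derivE ?(hornerMn, hornerE) /=; ring.
have fv u v : d_v f u v 0 = - (v *+ 2).
  by rewrite (@d_v_horner _ _ _ (fun u => (u ^+ 2)%:P - 'X^2)) => *;
    rewrite ?fE ?poly.derivE ?(hornerMn, hornerE) /=; ring.
have fuu u v : d_u (d_u f) u v 0 = 2.
  by rewrite (@d_u_horner _ _ _ (fun=> 'X *+ 2)) => *;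
    rewrite ?fu ?poly.derivE ?(hornerMn, hornerE) /=; ring.
have fuv u v : d_u (d_v f) u v 0 = 0.
  by rewrite (@d_u_horner _ _ _ (fun v => (- (v *+ 2))%:P)) => *;
    rewrite ?fv ?poly.derivE ?(hornerMn, hornerE) /=; ring.
have fvv u v : d_v (d_v f) u v 0 = - 2.
  by rewrite (@d_v_horner _ _ _ (fun=> - ('X *+ 2))) => *;
    rewrite ?fv ?poly.derivE ?(hornerMn, hornerE) /=; ring.
split; first by rewrite /critical_manifold /= fE expr0n subrr.
split; rewrite ?fu ?fv ?fuu ?mul0rn ?oppr0 ?pnatr_eq0 //.
have -> : \det (hessian f 0 0 0) = - 4; last by rewrite oppr_lt0 ltr0n.
(* In the expansion the entry [d_v (d_u f)] is multiplied by [d_u (d_v f)], which is 0, so only the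
   diagonal product remains. *)
rewrite (expand_det_row _ ord0) !big_ord_recl big_ord0 /cofactor !det_mx11.
by rewrite !mxE /= fuu fuv fvv; ring.
Qed.

(** Since [f] factors as [u * (v - u ^+ 2)], the line [u = 0] meets a parabola at the origin; the
    cubic term gives [f_uuu] and the product [u * v] gives the mixed derivative. *)
Lemma pitchfork_normal_form :
  (forall u v, f u v 0 = u * v - u ^+ 3) -> pitchfork_singularity f g.
Proof.
move=> fE.
have fu u v : d_u f u v 0 = v - u ^+ 2 *+ 3.
  by rewrite (@d_u_horner _ _ _ (fun v => 'X * v%:P - 'X^3)) => *;
    rewrite ?fE ?poly.derivE ?(hornerMn, hornerE) /=; ring.
have fv u v : d_v f u v 0 = u.
  by rewrite (@d_v_horner _ _ _ (fun u => u%:P * 'X - (u ^+ 3)%:P)) => *;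
    rewrite ?fE ?poly.derivE ?(hornerMn, hornerE) /=; ring.
have fuu u v : d_u (d_u f) u v 0 = - (u *+ 6).
  by rewrite (@d_u_horner _ _ _ (fun v => v%:P - 'X^2 *+ 3)) => *;
    rewrite ?fu ?poly.derivE ?(hornerMn, hornerE) /=; ring.
have fuuu u v : d_u (d_u (d_u f)) u v 0 = - 6.
  by rewrite (@d_u_horner _ _ _ (fun=> - ('X *+ 6))) => *;
    rewrite ?fuu ?poly.derivE ?(hornerMn, hornerE) /=; ring.
have fvu u v : d_v (d_u f) u v 0 = 1.
  by rewrite (@d_v_horner _ _ _ (fun u => 'X - (u ^+ 2 *+ 3)%:P)) => *;
    rewrite ?fu ?poly.derivE ?(hornerMn, hornerE) /=; ring.
split; first by rewrite /critical_manifold /= fE expr0n mul0r subrr.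
split; rewrite ?fuuu ?fvu ?oppr_eq0 ?pnatr_eq0 ?oner_eq0 //.
by rewrite fu fv fuu expr0n !mul0rn subr0 oppr0.
Qed.

End NormalForms.

Theorem theorem3 (K : realType) (w : 'I_3 -> nat) (Hw : forall i, (0 < w i)%N)
    (eps0 : K) (Heps0 : 0 < eps0) (P Q R : K -> {mpoly K[3]})
    (HP : analytic_family eps0 P) (HQ : analytic_family eps0 Q)
    (HR : analytic_family eps0 R)
    (delta : int) (Hdelta : is_wdegree w eps0 P Q R delta)
    (Hg : g_infty w delta Q R 0 0 0 != 0)
    (k1 k2 : nat) (Hk1 : (0 < k1)%N) (Hk2 : (0 < k2)%N) :
  let f := f_infty w delta P Q in
  let g := g_infty w delta Q R in
  let P_delta e := wcomp w ix delta (P e) in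
  let x : {mpoly K[3]} := 'X_ix in
  let y : {mpoly K[3]} := 'X_iy in
  let z : {mpoly K[3]} := 'X_iz in
  let w1 := (w ix)%:Z in let w2 := (w iy)%:Z in let w3 := (w iz)%:Z in
  [/\ (forall e, `|e| < eps0 -> P_delta e = x ^+ 2 * y ^+ k1 - y ^+ k2 * z) ->
      (fold_singularity f g <->
       k1%:Z * w2 = delta - w1 /\ k2%:Z * w2 = delta + w1 - w3),
      (forall e, `|e| < eps0 ->
         P_delta e = x ^+ 2 * y ^+ k1 - y ^+ k2 * z ^+ 2) ->
      (transcritical_singularity f g <->
       k1%:Z * w2 = delta - w1 /\ k2%:Z * w2 = delta + w1 - 2%:Z * w3)
    & (forall e, `|e| < eps0 ->
         P_delta e = x * y ^+ k1 * z - x ^+ 3 * y ^+ k2) ->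
      (pitchfork_singularity f g <->
       k1%:Z * w2 = delta - w3 /\ k2%:Z * w2 = delta - 2%:Z * w1)].
Proof.
move=> f g P_delta x y z w1 w2 w3.
have e0 : `|0 : K| < eps0 by rewrite normr0.
have fE u v : f u v 0 = (P_delta 0).@[pt u 1 v] by exact: f_infty0E.
have mE i j : (U_(i) : 'X_{1..3})%MM j = (i == j) := mnm1E i j.
(* All the singularity conditions are evaluated at eps = 0, so the formula for [P_delta] is
   specialised there. *)
split=> /(_ 0 e0) P0; split=> _.
- have := @wcomp_binomial _ w ix delta (P 0)
    (U_(ix) *+ 2 + U_(iy) *+ k1)%MM (U_(iy) *+ k2 + U_(iz))%MM.
  case.
  (* The two monomials differ in the exponent of [x]: 2 against 0. *)
  + by apply/eqP => /mnmP/(_ ix); rewrite !(mnmDE, mulmnE, mE).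
  + by rewrite !mpolyXD -!mpolyXn.
  (* The degrees give [2 w1 + k1 w2 = delta + w1] and [k2 w2 + w3 = delta + w1], linear once [k1 w2]
     and [k2 w2] are taken as unknowns. *)
  rewrite !wdegE !(mnmDE, mulmnE, mE) /= /w1 /w2 /w3; split; lia.
- apply: fold_normal_form => // u v; have [ex ey ez] := meval_xyz K u 1 v.
  by rewrite fE P0 rmorphB !rmorphM !rmorphXn /= ex ey ez !expr1n mulr1 mul1r.
- have := @wcomp_binomial _ w ix delta (P 0)
    (U_(ix) *+ 2 + U_(iy) *+ k1)%MM (U_(iy) *+ k2 + U_(iz) *+ 2)%MM.
  case.
  + by apply/eqP => /mnmP/(_ ix); rewrite !(mnmDE, mulmnE, mE).
  + by rewrite !mpolyXD -!mpolyXn.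
  rewrite !wdegE !(mnmDE, mulmnE, mE) /= /w1 /w2 /w3; split; lia.
- apply: transcritical_normal_form => // u v.
  have [ex ey ez] := meval_xyz K u 1 v.
  by rewrite fE P0 rmorphB !rmorphM !rmorphXn /= ex ey ez !expr1n mulr1 mul1r.
- have := @wcomp_binomial _ w ix delta (P 0)
    (U_(ix) + U_(iy) *+ k1 + U_(iz))%MM (U_(ix) *+ 3 + U_(iy) *+ k2)%MM.
  case.
  + by apply/eqP => /mnmP/(_ ix); rewrite !(mnmDE, mulmnE, mE).
  + by rewrite !mpolyXD -!mpolyXn.
  (* Here [w1 + k1 w2 + w3] and [3 w1 + k2 w2] both equal [delta + w1], and [w1] cancels. *)
  rewrite !wdegE !(mnmDE, mulmnE, mE) /= /w1 /w2 /w3; split; lia.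
- apply: pitchfork_normal_form => // u v; have [ex ey ez] := meval_xyz K u 1 v.
  by rewrite fE P0 rmorphB !rmorphM !rmorphXn /= ex ey ez !expr1n !mulr1.
Qed.
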